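(* Let $\mathbb D\subset\mathbb C$ be the open unit disc, and for $\lambda\in\mathbb D$ let $f_0=f_{0,\lambda}$ and $f_1=f_{1,\lambda}$ be rational functions on $\widehat{\mathbb C}$ depending analytically on $\lambda$. Let $p_0,p_1\in(0,1)$ with $p_0+p_1=1$. Assume that for every $\lambda\in\mathbb D$: (a) $0$ is a fixed point of both $f_0$ and $f_1$; writing $\mu(\lambda)=f_{0,\lambda}'(0)$ and $\nu(\lambda)=f_{1,\lambda}'(0)$, one has $|\mu(\lambda)|>1$ and $|\nu(\lambda)|<1$; (b) $\infty$ is a superattracting fixed point of $f_0$, the local degree of $f_0$ at $\infty$ being $d\ge 2$, and $f_1(\infty)=0$; (c) $f_0$ is hyperbolic, and every attracting fixed or periodic point of $f_0$ other than $\infty$ is mapped into the immediate basin of $\infty$ for $f_0$ by some iterate $f_1^k$; (d) $p_0\ln|\mu(\lambda)|+p_1\ln|\nu(\lambda)|>0$ (with $\ln 0=-\infty$). Let $\lambda\in\mathbb D$ be such that the set $$S_\lambda:=\overline{\{\mu(\lambda)^n\cdot\nu(\lambda)^m : n,m\in\mathbb N\}}$$ coincides with $\mathbb C$. Then there exists an $r>0$ such that for all $z\in B_r(0)\setminus\{0\}$ the $G_\lambda$-orbit of $z$ is dense in $\widehat{\mathbb C}$.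
   Context: $\widehat{\mathbb C}$ is the Riemann sphere and $B_r(0)=\{z\in\mathbb C:|z|<r\}$. $G_\lambda=\langle f_0,f_1\rangle$ is the semigroup of compositions of $f_0$ and $f_1$, and the $G_\lambda$-orbit of $z$ is $\{g(z):g\in G_\lambda\}$. The closure in the definition of $S_\lambda$ is taken in $\mathbb C$. A rational map (of degree at least $2$) is hyperbolic if each of its critical points converges under iteration to an attracting (possibly superattracting) periodic cycle. The immediate basin of $\infty$ for $f_0$ is the connected component containing $\infty$ of the basin of attraction of $\infty$ under $f_0$. The numbers $p_0,p_1$ are the probabilities with which $f_0,f_1$ are chosen in the associated iterated function system; here they enter only through (d). *)

(* Defs.v *)
From HB Require Import structures.
From mathcomp Require Import all_boot all_order all_algebra.
From mathcomp Require Import all_classical all_reals all_analysis.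
From mathcomp.real_closed Require Export complex.

Set Implicit Arguments.
Unset Strict Implicit.
Unset Printing Implicit Defensive.

Import Order.TTheory GRing.Theory Num.Theory.
Import numFieldNormedType.Exports.

Local Open Scope classical_set_scope.
Local Open Scope ring_scope.

(* R[i] packed as a numFieldType, so that it carries the norm topology and the
   complex normed-module structure declared for every
   numFieldType: [derive1] and [differentiable] below are complex. *)
Definition Cplx (R : realType) : numFieldType := R[i].

(* |z| as an element of R; the norm `|z| takes its values in the reals of R[i]. *)
Definition modulus (R : realType) (z : Cplx R) : R := complex.Re `|z|.

Definition sphere (R : realType) : topologicalType :=
  one_point_compactification (Cplx R).

Definition fin (R : realType) (z : Cplx R) : sphere R := Some z.
Definition infty (R : realType) : sphere R := None.

Section Sphere.
Context {R : realType}.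
Local Notation C := (Cplx R).
Local Notation S := (sphere R).

(* The holomorphic chart centred at a, namely z - a if a is finite and 1/z if
   a = infty, and its inverse. The value 0 of the first chart at infty and the
   value 0^-1 = 0 of the second chart at 0 are meaningless. *)
Definition chart (a z : S) : C :=
  match a, z with
  | Some a, Some z => z - a
  | None, Some z => z^-1
  | _, None => 0
  end.

Definition chart_inv (a : S) (w : C) : S :=
  match a with
  | Some a => fin (a + w)
  | None => if w == 0 then infty R else fin w^-1
  end.

Definition in_charts (f : S -> S) (a : S) (w : C) : C :=
  chart (f a) (f (chart_inv a w)).

(* The usual f'(a) if a and f a are finite; if f a = a this is the multiplier
   of f at a, also when a = infty. *)
Definition deriv_at (f : S -> S) (a : S) : C := derive1 (in_charts f a) 0.

Definition critical_point (f : S -> S) (a : S) : Prop := deriv_at f a = 0.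

(* In the charts centred at a and f a, f has the form c w^d + o(w^d), c != 0. *)
Definition local_degree (f : S -> S) (a : S) (d : nat) : Prop :=
  exists2 c : C, c != 0 & in_charts f a w / w ^+ d @[w --> 0^'] --> c.

(* The map z |-> p(z) / q(z) for q != 0 and p, q coprime. *)
Definition ratmap (p q : {poly C}) (z : S) : S :=
  match z with
  | Some z => if q.[z] == 0 then infty R else fin (p.[z] / q.[z])
  | None => if (size q < size p)%N then infty R
            else fin (p`_(size q).-1 / lead_coef q)
  end.

Definition rational_of_degree (n : nat) (f : S -> S) : Prop :=
  exists p q : {poly C},
    [/\ q != 0, coprimep p q, f = ratmap p q & n = (maxn (size p) (size q)).-1].

Definition rational_map (f : S -> S) : Prop := exists n, rational_of_degree n f.

(* Each f_l, |l| < 1, is rational and (l, z) |-> f_l(z) is a holomorphic map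
   from (unit disc) x sphere to the sphere: it is continuous, and complex
   differentiable in the charts centred at each point and at its image.
   Continuity also keeps the meaningless values of the charts out of play. *)
Definition analytic_family (f : C -> S -> S) : Prop :=
  forall l : C, modulus l < 1 ->
    rational_map (f l) /\
    forall z : S,
      {for (l, z), continuous (fun x : C * S => f x.1 x.2)} /\
      differentiable
        (fun x : C * C => chart (f l z) (f x.1 (chart_inv z x.2))) (l, 0 : C).

Definition attracting_periodic (f : S -> S) (n : nat) (a : S) : Prop :=
  [/\ (0 < n)%N, iter n f a = a & modulus (deriv_at (iter n f) a) < 1].

Definition forward_orbit (f : S -> S) (a : S) : set S :=
  [set iter k f a | k in [set: nat]].

Definition converges_to_set (u : nat -> S) (A : set S) : Prop :=
  forall U : set S, open U -> A `<=` U -> \forall k \near \oo, U (u k).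

Definition hyperbolic (f : S -> S) : Prop :=
  (exists2 n, (2 <= n)%N & rational_of_degree n f) /\
  forall c, critical_point f c ->
    exists (n : nat) (a : S), attracting_periodic f n a /\
      converges_to_set (fun k => iter k f c) (forward_orbit f a).

Definition superattracting_fixed (f : S -> S) (a : S) : Prop :=
  f a = a /\ deriv_at f a = 0.

Definition basin (f : S -> S) (a : S) : set S :=
  [set z | iter k f z @[k --> \oo] --> a].

Definition immediate_basin (f : S -> S) (a : S) : set S :=
  connected_component (basin f a) a.

Inductive semigroup (f0 f1 : S -> S) : (S -> S) -> Prop :=
| semigroup_gen0 : semigroup f0 f1 f0
| semigroup_gen1 : semigroup f0 f1 f1
| semigroup_comp g h :
    semigroup f0 f1 g -> semigroup f0 f1 h -> semigroup f0 f1 (g \o h).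

Definition semigroup_orbit (f0 f1 : S -> S) (z : S) : set S :=
  [set g z | g in semigroup f0 f1].

End Sphere.

(* Main.v *)
Require Import Defs.
From mathcomp Require Import all_boot all_order all_algebra.
From mathcomp Require Import all_classical all_reals all_analysis.
From mathcomp Require Import cyclic separable cyclotomic.
From mathcomp Require Import zify ring lra.

Import Order.TTheory GRing.Theory Num.Theory.
Import numFieldNormedType.Exports.

Local Open Scope classical_set_scope.
Local Open Scope ring_scope.

(* Near 0 both maps are conjugate to their linear parts, so f0^n (f1^m z) is
   governed by mu^n nu^m: comparing x m = f1^m z with a backward f0-orbit u n of
   a small y, the ratio x m / u n is asymptotically a constant times
   mu^n nu^m, hence can be brought arbitrarily close to 1, and then
   f0^n (x m) is close to f0^n (u n) = y. So the orbit of z is dense near 0.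
   The images of a disc about 0 under the iterates f0^n cover a dense set: if
   they avoided a ball around v, the functions 1 / (f0^n - v) would be uniformly
   bounded on the disc, contradicting the Schwarz lemma because f0^n maps 0 to 0
   and u n -> 0 to y. *)

(** The comparison of [x m] with [u n] must be relative to |u n|: both points tend to 0 while f0^n
    expands by about |mu|^n, so absolute closeness says nothing. Linearizing coordinates are never
    constructed. A map fixing 0 is written as z * G z with G Lipschitz; then x m / nu^m and mu^n u n
    are partial products whose factors tend to 1 geometrically, and it suffices that each stays
    within a small relative error of one fixed term. The complex analysis concerns rational
    functions only and is replaced by algebra: Cauchy estimates come from averages over roots of
    unity, holomorphy is replaced by uniform approximation by polynomials, local preimages come from
    the location of roots, and iterates with poles are handled in homogeneous coordinates. Division
    by nu is legitimate because (d) excludes nu = 0. *)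

Section Modulus.
Context {R : realType}.
Local Notation C := (Cplx R).
Implicit Types (x y z : C) (p q : {poly C}).

(** * Real absolute values and discs in the sphere *)

Lemma modulusE z : modulus z = ComplexField.Normc.normc z.
Proof. by []. Qed.

Lemma normE z : `|z| = (modulus z)%:C%C :> C.
Proof. by []. Qed.

Lemma modulus_ge0 z : 0 <= modulus z.
Proof. by rewrite -ler0c -normE normr_ge0. Qed.

Lemma modulusM x y : modulus (x * y) = modulus x * modulus y.
Proof. exact: ComplexField.Normc.normcM. Qed.

Lemma modulusD x y : modulus (x + y) <= modulus x + modulus y.
Proof. exact: le_normcD. Qed.

Lemma modulusN x : modulus (- x) = modulus x.
Proof. exact: normcN. Qed.

Lemma modulusB x y : modulus (x - y) <= modulus x + modulus y.
Proof. by rewrite -(modulusN y); exact: modulusD. Qed.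

Lemma modulus_distC x y : modulus (x - y) = modulus (y - x).
Proof. by rewrite -modulusN opprB. Qed.

Lemma modulus0 : modulus (0 : C) = 0.
Proof. exact: ComplexField.Normc.normc0. Qed.

Lemma modulus1 : modulus (1 : C) = 1.
Proof. exact: ComplexField.Normc.normc1. Qed.

Lemma modulusV x : modulus x^-1 = (modulus x)^-1.
Proof. exact: ComplexField.Normc.normcV. Qed.

Lemma modulus_eq0 x : (modulus x == 0) = (x == 0).
Proof.
apply/eqP/eqP => [/ComplexField.Normc.eq0_normc//|->]; exact: modulus0.
Qed.

Lemma modulus_gt0 x : (0 < modulus x) = (x != 0).
Proof. by rewrite lt0r modulus_ge0 andbT modulus_eq0. Qed.

Lemma modulusX x n : modulus (x ^+ n) = modulus x ^+ n.
Proof.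
by elim: n => [|n IHn]; rewrite ?expr0 ?modulus1// !exprS modulusM IHn.
Qed.

Lemma modulus_real (a : R) : modulus (a%:C%C : C) = `|a|.
Proof. by rewrite modulusE /= expr0n /= addr0 sqrtr_sqr. Qed.

Lemma modulus_nat n : modulus (n%:R : C) = n%:R.
Proof.
have -> : (n%:R : C) = (n%:R : R)%:C%C by rewrite (rmorph_nat (real_complex R)).
by rewrite modulus_real ger0_norm.
Qed.

Lemma modulus_sum (I : Type) (r : seq I) (P : pred I) (F : I -> C) :
  modulus (\sum_(i <- r | P i) F i) <= \sum_(i <- r | P i) modulus (F i).
Proof.
elim/big_rec2: _ => [|i a b _ le_ab]; first by rewrite modulus0.
by apply: le_trans (modulusD _ _) _; rewrite lerD2l.
Qed.

Lemma modulus_triangle z x y : modulus (x - y) <= modulus (x - z) + modulus (z - y).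
Proof. by rewrite (le_trans _ (modulusD _ _))// addrA subrK. Qed.

(** Balls of the norm topology have radii in [R[i]], but a positive element of [R[i]] is real, so
    real radii suffice. *)
Lemma nbhs_modulusP z (A : set C) :
  nbhs z A <-> exists2 e : R, 0 < e & forall x, modulus (x - z) < e -> A x.
Proof.
split=> [/nbhs_ballP[e /= e0 eA]|[e e0 eA]].
  have eE : e = (complex.Re e)%:C%C by rewrite RRe_real// gtr0_real.
  exists (complex.Re e); first by rewrite -ltcR -eE.
  move=> x xz; apply: eA; rewrite -ball_normE /= distrC normE eE.
  by rewrite ltcR.
apply/nbhs_ballP; exists e%:C%C => /=; first by rewrite ltcR.
by move=> x; rewrite -ball_normE /= distrC normE ltcR => /eA.
Qed.

Lemma closure_modulusP (A : set C) z :
  closure A z -> forall e : R, 0 < e -> exists2 x, A x & modulus (x - z) < e.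
Proof.
move=> clA e e0.
have /clA[x []] : nbhs z [set x | modulus (x - z) < e].
  by apply/nbhs_modulusP; exists e.
by exists x.
Qed.

Lemma nbhs_fin z (A : set (sphere R)) : nbhs (fin z) A ->
  exists2 e : R, 0 < e & forall x, modulus (x - z) < e -> A (fin x).
Proof. by move=> /one_point_compactification_some_continuous/nbhs_modulusP. Qed.

Lemma continuous_modulus : continuous (fun z : C => modulus z).
Proof.
move=> z; apply/(@cvgrPdist_lt R R^o C (nbhs z)) => e e0.
apply/nbhs_modulusP; exists e => // x xz.
apply: le_lt_trans xz; rewrite ler_norml.
have := modulusD (x - z) z; have := modulusD (z - x) x.
rewrite !subrK (modulus_distC z) => *; lra.
Qed.

Lemma compact_modulus_bounded (K : set C) : compact K ->
  exists M : R, forall z, K z -> modulus z <= M.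
Proof.
move=> cK.
have cmK : compact ((fun z : C => modulus z) @` K).
  apply: continuous_compact => //; apply: continuous_subspaceT.
  exact: continuous_modulus.
have [M [_ KM]] := compact_bounded cmK; exists (M + 1) => z Kz.
apply: le_trans (ler_norm _) _.
by apply: (KM (M + 1)); [rewrite ltrDl | exists z].
Qed.

(** The centre is moved off 0 because the function 1 / (f0^n - v) will be evaluated at 0, where it
    is -1 / v. *)
Lemma open_sphere_fin (O : set (sphere R)) : open O -> O !=set0 ->
  exists z e, [/\ z != 0, 0 < e & forall x, modulus (x - z) < e -> O (fin x)].
Proof.
move=> oO O0.
suff [z [e [e0 zO]]] : exists z e, 0 < e /\
    forall x, modulus (x - z) < e -> O (fin x).
  have [z0|z0] := eqVneq z 0; last by exists z, e.
  have m2 : modulus ((e / 2)%:C%C : C) = e / 2.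
    by rewrite modulus_real ger0_norm// ltW// divr_gt0.
  exists (e / 2)%:C%C, (e / 2); rewrite -modulus_gt0 m2; split; rewrite ?divr_gt0//.
  move=> x xe; apply: zO; rewrite z0 subr0.
  have := modulusD (x - (e / 2)%:C%C) (e / 2)%:C%C.
  by rewrite subrK m2; lra.
case: O0 => -[z|] Oz.
  have /nbhs_fin[e e0 zO] : nbhs (fin z) O by exact: open_nbhs_nbhs.
  by exists z, e.
(* A neighbourhood of [infty R] contains all finite points outside a compact set; the unit disc
   about |M| + 2 lies beyond the bound M of that set. *)
have [K [cK clK] KO] : nbhs (infty R) O by exact: open_nbhs_nbhs.
have [M KM] := compact_modulus_bounded _ cK.
pose z : C := (`|M| + 2)%:C%C.
have mz : modulus z = `|M| + 2 by rewrite modulus_real ger0_norm// addr_ge0.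
exists z, 1; split => // x xz; apply: KO; left; exists x => //= Kx.
have := KM _ Kx; have := modulusD (z - x) x; have := ler_norm M.
by rewrite subrK mz (modulus_distC z) => *; lra.
Qed.

End Modulus.

(** * Cauchy estimates and a Schwarz inequality for rational functions *)

Section Schwarz.
Context {R : realType}.
Local Notation C := (Cplx R).
Implicit Types (x y z w : C) (p q : {poly C}) (r M : R) (h k : C -> C).

Lemma Cplx_poly_normal p :
  {s : seq C | p = lead_coef p *: \prod_(z <- s) ('X - z%:P)}.
Proof. exact: (@closed_field_poly_normal R[i]). Qed.

Lemma Cplx_prim_root n : (0 < n)%N -> {w : C | n.-primitive_root w}.
Proof.
move=> n0; pose p : {poly C} := 'X^n - 1.
have [s pE] := Cplx_poly_normal p; apply/cid.
rewrite (monicP _) ?monicXnsubC// scale1r in pE.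
have ps : all n.-unity_root s by apply/allP => z; rewrite -root_prod_XsubC -pE.
have sz_s : (n < (size s).+1)%N.
  by rewrite -(size_prod_XsubC s id) -pE size_XnsubC.
have [|z] := hasP (has_prim_root n0 ps _ sz_s); last by exists z.
by rewrite -separable_prod_XsubC -pE separable_Xn_sub_1// pnatr_eq0 -lt0n.
Qed.

Lemma sum_prim_root n (w : C) a : n.-primitive_root w ->
  \sum_(k < n) (w ^+ a) ^+ k = if (n %| a)%N then n%:R else 0.
Proof.
move=> wP; case: ifPn => [|na].
  rewrite (prim_order_dvd wP) => /eqP ->.
  under eq_bigr do rewrite expr1n.
  by rewrite sumr_const card_ord.
apply/eqP; have := subrX1 (w ^+ a) n.
rewrite exprAC (prim_expr_order wP) expr1n subrr => /eqP.
by rewrite eq_sym mulf_eq0 subr_eq0 -(prim_order_dvd wP) (negPf na).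
Qed.

(** Discrete Cauchy formula: orthogonality of the characters of the n-th roots of unity isolates one
    coefficient. The exponent [k * (n - j)] stands for -kj. *)
Lemma coef_prim_root n w p x (j : 'I_n) :
  n.-primitive_root w -> (size p <= n)%N ->
  \sum_(k < n) p.[x * w ^+ k] * w ^+ (k * (n - j)) = n%:R * (p`_j * x ^+ j).
Proof.
move=> wP pn.
under eq_bigr => k _ do rewrite (horner_coef_wide _ pn) mulr_suml.
rewrite exchange_big /= (bigD1 j)//= [X in _ + X]big1 ?addr0 => [|i ij].
  transitivity (\sum_(k < n) p`_j * x ^+ j * (w ^+ n) ^+ k).
    apply: eq_bigr => k _; rewrite exprMn -!exprM -!mulrA -exprD -mulnDr.
    by rewrite subnKC 1?ltnW// mulnC.
  rewrite -mulr_sumr (sum_prim_root _ _ _ wP) dvdnn.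
  by rewrite mulrC.
transitivity (\sum_(k < n) p`_i * x ^+ i * (w ^+ (i + (n - j))) ^+ k).
  apply: eq_bigr => k _.
  by rewrite exprMn -!exprM -!mulrA -exprD -mulnDr mulnC.
rewrite -mulr_sumr (sum_prim_root _ _ _ wP) ifN ?mulr0//.
have := ltn_ord i; have := ltn_ord j => jn lin.
apply: contra ij => /dvdnP[m mE].
(* [i + (n - j)] lies strictly between 0 and 2n, so as a multiple of n it equals n, which forces i =
   j. *)
have m1 : (m = 1)%N.
  have : (0 < i + (n - j) < 2 * n)%N by lia.
  rewrite mE; case: m {mE} => [|[|m]]//; rewrite ?mul0n//.
  by rewrite ltn_mul2r !ltnS ltn0 !andbF.
by apply/eqP/val_inj => /=; lia.
Qed.

Lemma poly_cauchy_estimate p r M j : 0 <= r ->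
  (forall z, modulus z = r -> modulus p.[z] <= M) ->
  modulus p`_j * r ^+ j <= M.
Proof.
move=> r0 pM; pose n := (maxn (size p) j).+1.
have [w wP] := Cplx_prim_root n isT.
have jn : (j < n)%N by rewrite ltnS leq_maxr.
have := coef_prim_root n w p (r%:C%C : C) (Ordinal jn) wP (leqW (leq_maxl _ _)).
move=> /(congr1 (@modulus R)); rewrite !modulusM modulus_nat modulusX.
rewrite modulus_real ger0_norm//= => E.
rewrite -(@ler_pM2l _ n%:R) ?ltr0n// -E.
apply: le_trans (modulus_sum _ _ _ _) _.
have -> : n%:R * M = \sum_(k < n) M by rewrite sumr_const card_ord mulr_natl.
have mw : modulus w = 1.
  apply/eqP; rewrite -(@pexpr_eq1 _ _ n) ?modulus_ge0//.
  by rewrite -modulusX (prim_expr_order wP) modulus1.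
apply: ler_sum => k _; rewrite modulusM modulusX mw expr1n mulr1 pM//.
by rewrite modulusM modulusX mw expr1n mulr1 modulus_real ger0_norm.
Qed.

Lemma geometric_sum_le2 (t : R) n : 0 <= t <= 1/2 -> \sum_(i < n) t ^+ i <= 2.
Proof.
move=> /andP[t0 t1]; have := subrX1 t n.
have : 0 <= t ^+ n by rewrite exprn_ge0.
have : 0 <= \sum_(i < n) t ^+ i by apply: sumr_ge0 => i _; rewrite exprn_ge0.
nra.
Qed.

(** The Cauchy estimates bound the terms of degree at least 1 by a geometric series of ratio |w| /
    r, at most 1/2; hence the factor 2. *)
Lemma poly_schwarz p r M w : 0 < r ->
  (forall z, modulus z = r -> modulus p.[z] <= M) ->
  modulus w <= r / 2 -> modulus (p.[w] - p.[0]) <= 2 * M * modulus w / r.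
Proof.
move=> r0 pM wr.
have M0 : 0 <= M.
  apply: le_trans (modulus_ge0 _) (pM r%:C%C _).
  by rewrite modulus_real ger0_norm// ltW.
set t := modulus w / r.
have t0 : 0 <= t by rewrite divr_ge0 ?modulus_ge0// ltW.
have t1 : t <= 1/2 by rewrite ler_pdivrMr// mulrC mul1r.
(* Padding with a zero coefficient lets the constant term be split off even when [p] is 0. *)
rewrite (horner_coef_wide w (leqnSn (size p))) big_ord_recl expr0 mulr1.
rewrite horner_coef0 addrC addKr; apply: le_trans (modulus_sum _ _ _ _) _.
apply: (@le_trans _ _ (M * t * \sum_(i < size p) t ^+ i)).
  rewrite mulr_sumr; apply: ler_sum => i _; rewrite -mulrA -exprS.
  rewrite modulusM modulusX.
  have -> : M * t ^+ i.+1 = M / r ^+ i.+1 * modulus w ^+ i.+1.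
    by rewrite /t expr_div_n mulrA mulrAC.
  rewrite ler_wpM2r ?exprn_ge0 ?modulus_ge0// ler_pdivlMr ?exprn_gt0//.
  exact: poly_cauchy_estimate (ltW r0) pM.
have := geometric_sum_le2 t (size p); rewrite t0 t1 => /(_ isT) S2.
have -> : 2 * M * modulus w / r = M * t * 2 by rewrite /t; ring.
by rewrite ler_wpM2l// mulr_ge0.
Qed.

(** This replaces holomorphy on the closed disc: it is stable under products, and the Schwarz
    inequality passes to the limit. *)
Definition poly_approx r h := forall e : R, 0 < e ->
  exists p, forall z, modulus z <= r -> modulus (h z - p.[z]) <= e.

Lemma poly_approx_horner r p : poly_approx r (fun z => p.[z]).
Proof. by move=> e e0; exists p => z _; rewrite subrr modulus0 ltW. Qed.

Lemma poly_disc_bounded r p : 0 <= r ->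
  exists2 M, 0 < M & forall z, modulus z <= r -> modulus p.[z] <= M.
Proof.
move=> r0; elim/poly_ind: p => [|p c [M M0 pM]].
  by exists 1 => // z _; rewrite horner0 modulus0.
exists (M * r + modulus c + 1) => [|z zr].
  by rewrite ltr_wpDl// addr_ge0 ?modulus_ge0// mulr_ge0// ltW.
rewrite hornerMXaddC (le_trans (modulusD _ _))// modulusM.
suff : modulus p.[z] * modulus z <= M * r by lra.
by rewrite ler_pM ?modulus_ge0// pM.
Qed.

Lemma poly_approx_bounded r h : 0 <= r -> poly_approx r h ->
  exists2 M, 0 < M & forall z, modulus z <= r -> modulus (h z) <= M.
Proof.
move=> r0 /(_ _ ltr01)[p hp]; have [M M0 pM] := poly_disc_bounded _ p r0.
exists (M + 1) => [|z zr]; first lra.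
have := modulusD (h z - p.[z]) p.[z]; rewrite subrK.
by have := hp _ zr; have := pM _ zr; lra.
Qed.

Lemma poly_approxM r h k : 0 <= r -> poly_approx r h -> poly_approx r k ->
  poly_approx r (fun z => h z * k z).
Proof.
move=> r0 hA kA e e0.
have [M M0 hM] := poly_approx_bounded _ _ r0 hA.
(* [q] is chosen before [p]: its bound N decides how well [p] has to approximate [h]. *)
have [q kq] := kA _ (divr_gt0 e0 (mulr_gt0 (ltr0n R 2) M0)).
have [N N0 qN] := poly_disc_bounded _ q r0.
have [p hp] := hA _ (divr_gt0 e0 (mulr_gt0 (ltr0n R 2) N0)).
exists (p * q) => z zr.
have -> : h z * k z - (p * q).[z] =
    h z * (k z - q.[z]) + (h z - p.[z]) * q.[z] by rewrite hornerM; ring.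
apply: le_trans (modulusD _ _) _; rewrite !modulusM.
have -> : e = M * (e / (2 * M)) + e / (2 * N) * N by field; rewrite !gt_eqF.
by rewrite lerD// ler_pM ?modulus_ge0 ?hM ?kq ?hp ?qN.
Qed.

Lemma exprn_small (t : R) (e : R) : 0 <= t < 1 -> 0 < e ->
  exists n, forall m, (n <= m)%N -> t ^+ m <= e.
Proof.
move=> /andP[t0 t1] e0.
have /cvgrPdist_le/(_ e e0)[n _ nP] : t ^+ n @[n --> \oo] --> (0 : R^o).
  by apply: cvg_expr; rewrite ger0_norm.
exists n => m nm; have := nP m nm.
by rewrite /= sub0r normrN ger0_norm// exprn_ge0.
Qed.

(** Partial sums of the geometric series of 1 / (z - w) in z / w; the remainder is (z / w)^n / (z -
    w), with denominator at least |w| - r. *)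
Lemma poly_approx_inv r w : 0 <= r < modulus w ->
  poly_approx r (fun z => (z - w)^-1).
Proof.
move=> /andP[r0 rw] e e0.
have w0 : 0 < modulus w by apply: le_lt_trans rw.
have t1 : 0 <= r / modulus w < 1.
  by rewrite divr_ge0 ?modulus_ge0//= ltr_pdivrMr// mul1r.
have d0 : 0 < modulus w - r by rewrite subr_gt0.
have [n /(_ n (leqnn n)) nP] := exprn_small _ _ t1 (mulr_gt0 e0 d0).
exists (- w^-1 *: \sum_(i < n) (w^-1 *: 'X) ^+ i) => z zr.
have zw : modulus w - r <= modulus (z - w).
  by have := modulusD (w - z) z; rewrite subrK modulus_distC; lra.
have zw0 : z - w != 0 by rewrite -modulus_gt0; apply: lt_le_trans zw.
have wn0 : w != 0 by rewrite -modulus_gt0.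
have -> : (- w^-1 *: \sum_(i < n) (w^-1 *: 'X) ^+ i).[z] =
    (1 - (z / w) ^+ n) / (z - w).
  rewrite hornerZ horner_sum.
  under eq_bigr do rewrite horner_exp hornerZ hornerX mulrC.
  have -> : 1 - (z / w) ^+ n = - ((z / w) ^+ n - 1) by rewrite opprB.
  rewrite subrX1; set S := \sum_(i < n) _.
  by field; rewrite zw0 wn0.
have -> : (z - w)^-1 - (1 - (z / w) ^+ n) / (z - w) = (z / w) ^+ n / (z - w).
  by field; rewrite zw0.
rewrite modulusM modulusV ler_pdivrMr ?(lt_le_trans d0 zw)//.
apply: (@le_trans _ _ (e * (modulus w - r))); last by rewrite ler_wpM2l// ltW.
apply: le_trans nP; rewrite modulusX lerXn2r ?nnegrE ?modulus_ge0//.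
  by case/andP: t1.
by rewrite modulusM modulusV ler_wpM2r// invr_ge0 modulus_ge0.
Qed.

(** The denominator splits into linear factors whose roots all lie outside the disc, so the previous
    case applies factor by factor. *)
Lemma poly_approx_ratfun r p q : 0 <= r ->
  (forall z, modulus z <= r -> q.[z] != 0) ->
  poly_approx r (fun z => p.[z] / q.[z]).
Proof.
move=> r0 q0; apply: poly_approxM => //; first exact: poly_approx_horner.
have [s qE] := Cplx_poly_normal q; rewrite qE in q0 *.
have c0 : lead_coef q != 0.
  apply: contraTneq (q0 0 _); last by rewrite modulus0.
  by move=> ->; rewrite scale0r horner0 eqxx.
move: (lead_coef q) c0 q0 => c c0; clear qE.
elim: s => [|w s IHs] q0.
  have -> : (fun z => (c *: \prod_(z <- [::]) ('X - z%:P)).[z]^-1) =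
      (fun z => (c^-1)%:P.[z]).
    by apply/funext => z; rewrite big_nil hornerZ !hornerE.
  exact: poly_approx_horner.
have -> : (fun z => (c *: \prod_(z <- w :: s) ('X - z%:P)).[z]^-1) =
    (fun z => (z - w)^-1 * (c *: \prod_(z <- s) ('X - z%:P)).[z]^-1).
  apply/funext => z; rewrite big_cons scalerAr hornerM hornerXsubC.
  by rewrite invfM.
apply: poly_approxM => //.
  apply: poly_approx_inv; rewrite r0 ltNge /=.
  apply: contraL (@eqxx _ (0 : C)) => /q0.
  by rewrite big_cons scalerAr hornerM hornerXsubC subrr mul0r.
apply: IHs => z /q0; rewrite big_cons scalerAr hornerM.
by rewrite mulf_eq0 negb_or => /andP[].
Qed.

Lemma ratfun_schwarz r M p q w : 0 < r ->
  (forall z, modulus z <= r -> q.[z] != 0) ->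
  (forall z, modulus z <= r -> modulus (p.[z] / q.[z]) <= M) ->
  modulus w <= r / 2 ->
  modulus (p.[w] / q.[w] - p.[0] / q.[0]) <= 2 * M * modulus w / r.
Proof.
move=> r0 q0 hM wr.
apply/ler_addgt0Pr => e e0.
(* The approximation costs e/3 at [w], e/3 at 0, and 2 (e/3) |w| / r <= e/3 through the enlarged
   bound M + e/3. *)
have e30 : 0 < e / 3 by rewrite divr_gt0.
have [f fA] := poly_approx_ratfun _ p _ (ltW r0) q0 _ e30.
have fM z : modulus z = r -> modulus f.[z] <= M + e / 3.
  move=> zr; have zr' : modulus z <= r by rewrite zr.
  have := modulusB (p.[z] / q.[z]) (p.[z] / q.[z] - f.[z]).
  by rewrite opprB addrC subrK; have := fA _ zr'; have := hM _ zr'; lra.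
have := poly_schwarz _ _ _ _ r0 fM wr.
have wr' : modulus w <= r by lra.
have := fA _ wr'; have := fA 0; rewrite modulus0 => /(_ (ltW r0)).
have t1 : modulus w / r <= 1/2 by rewrite ler_pdivrMr// mulrC mul1r.
have E N : 2 * N * modulus w / r = 2 * N * (modulus w / r) by rewrite mulrA.
rewrite !E; set t := modulus w / r in t1 *.
set a := p.[w] / q.[w]; set b := p.[0] / q.[0] => b3 a3 fwt.
have := modulusD (a - f.[w]) (f.[w] - f.[0]).
have := modulusB (a - f.[0]) (b - f.[0]).
rewrite addrA subrK opprB addrA subrK => ab af.
have et : e * t <= e * (1 / 2) by rewrite ler_wpM2l// ltW.
by lra.
Qed.

End Schwarz.

(** * Orbits near a repelling and an attracting fixed point *)

Section Linearization.
Context {R : realType}.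
Local Notation C := (Cplx R).
Implicit Types (x y z w : C) (r s t K : R) (G : C -> C).

Lemma sum_geometric_le s n : 0 <= s < 1 -> \sum_(i < n) s ^+ i <= (1 - s)^-1.
Proof.
move=> /andP[s0 s1]; have d0 : 0 < 1 - s by rewrite subr_gt0.
rewrite -[leRHS]mul1r ler_pdivlMr//; have := subrX1 s n.
have sn0 : 0 <= s ^+ n by rewrite exprn_ge0.
lra.
Qed.

(** A convergent infinite product in the only form used: comparison with a single term [a N]
    replaces the limit and its non-vanishing. *)
Lemma relative_cauchy (a e : nat -> C) (A t eta : R) :
  0 <= t < 1 -> 0 <= A -> 0 < eta ->
  (forall n, a n.+1 = a n * (1 + e n)) -> (forall n, modulus (e n) <= A * t ^+ n) ->
  exists N, forall m, (N <= m)%N -> modulus (a m - a N) <= eta * modulus (a N).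
Proof.
move=> t01 A0 eta0 aS eA; have /andP[t0 t1] := t01.
(* The cap at 1 gives |a (N + k)| <= 2 |a N| during the induction. N is taken so large that 2 A t^N
   / (1 - t) <= h; [A + 1] covers the case A = 0. *)
pose h := Num.min eta 1.
have h0 : 0 < h by rewrite lt_min eta0 ltr01.
have [h_eta h1] : h <= eta /\ h <= 1 by rewrite !ge_min !lexx orbT.
have d0 : 0 < 1 - t by rewrite subr_gt0.
have b0 : 0 < h * (1 - t) / (2 * (A + 1)).
  by rewrite divr_gt0 ?mulr_gt0// ltr_wpDl.
have [N /(_ N (leqnn N)) NP] := exprn_small _ _ t01 b0.
exists N => m Nm; rewrite -(subnKC Nm); move: (m - N)%N => k {m Nm}.
apply: (@le_trans _ _ (h * modulus (a N))); last first.
  by rewrite ler_wpM2r// modulus_ge0.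
pose S j := 2 * (A * t ^+ N) * \sum_(i < j) t ^+ i.
have Sh j : S j <= h.
  have AN0 : 0 <= A * t ^+ N by rewrite mulr_ge0// exprn_ge0.
  have AN : A * t ^+ N * 2 <= h * (1 - t).
    rewrite ler_pdivlMr ?mulr_gt0// ?ltr_wpDl// in NP.
    have : 0 <= t ^+ N by rewrite exprn_ge0.
    lra.
  apply: (@le_trans _ _ (2 * (A * t ^+ N) * (1 - t)^-1)).
    by apply: ler_wpM2l; [exact: mulr_ge0|exact: sum_geometric_le].
  by rewrite ler_pdivrMr// mulrC.
suff : modulus (a (N + k)%N - a N) <= S k * modulus (a N).
  by move=> /le_trans; apply; rewrite ler_wpM2r// modulus_ge0.
elim: k => [|k IHk].
  by rewrite addn0 subrr modulus0 /S big_ord0 mulr0 mul0r.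
have -> : a (N + k.+1)%N - a N = a (N + k)%N - a N + a (N + k)%N * e (N + k)%N.
  by rewrite addnS aS; ring.
apply: le_trans (modulusD _ _) _; rewrite /S big_ord_recr /= mulrDr mulrDl.
apply: lerD => //; rewrite modulusM.
have aN0 := modulus_ge0 (a N).
have ak : modulus (a (N + k)%N) <= 2 * modulus (a N).
  have := modulusD (a (N + k)%N - a N) (a N); rewrite subrK.
  have := Sh k; nra.
have ek := eA (N + k)%N; rewrite exprD mulrA in ek.
apply: (@le_trans _ _ (2 * modulus (a N) * (A * t ^+ N * t ^+ k))).
  by rewrite ler_pM ?modulus_ge0.
by rewrite le_eqVlt; apply/orP; left; apply/eqP; ring.
Qed.

Lemma forward_orbit_decay G r s x n : 0 <= s <= 1 ->
  (forall z, modulus z <= r -> modulus (G z) <= s) -> modulus x <= r ->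
  modulus (iter n (fun z => z * G z) x) <= s ^+ n * modulus x.
Proof.
move=> /andP[s0 s1] Gs xr; elim: n => [|n IHn]; first by rewrite mul1r.
rewrite iterS modulusM mulrC exprS -mulrA ler_pM ?modulus_ge0//.
apply: Gs; apply: le_trans IHn _; apply: le_trans xr.
by rewrite ler_piMl ?modulus_ge0// exprn_ile1.
Qed.

Lemma backward_orbit_decay G r s (u : nat -> C) n : 0 < s ->
  (forall z, modulus z <= r -> s^-1 <= modulus (G z)) ->
  (forall n, modulus (u n) <= r /\ u n = u n.+1 * G (u n.+1)) ->
  modulus (u n) <= s ^+ n * modulus (u 0%N).
Proof.
move=> s0 Gs uP; elim: n => [|n IHn]; first by rewrite mul1r.
rewrite exprS -mulrA -ler_pdivrMl//; apply: le_trans IHn.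
rewrite [in leRHS](uP n).2 modulusM mulrC ler_wpM2l ?modulus_ge0//.
exact: Gs (uP _).1.
Qed.

(* A relative perturbation t of u n is amplified, while F^n brings it back to
   u 0, at most by the product of the 1 + 2 K |u j|, which is at most 2 because
   the u j decay geometrically. *)
Lemma backward_orbit_stable G r K s (u : nat -> C) n t (a : C) :
  0 < s < 1 -> 0 <= K -> 4 * K * r <= 1 - s ->
  (forall z w, modulus z <= r -> modulus w <= r ->
     modulus (G z - G w) <= K * modulus (z - w)) ->
  (forall z, modulus z <= r -> s^-1 <= modulus (G z)) ->
  (forall n, 2 * modulus (u n) <= r /\ u n = u n.+1 * G (u n.+1)) ->
  0 <= t <= 1 / 2 -> modulus (a - u n) <= t * modulus (u n) ->
  let F := fun z => z * G z in
  (forall k, (k <= n)%N -> modulus (iter k F a) <= r) /\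
  modulus (iter n F a - u 0%N) <= 2 * t * modulus (u 0%N).
Proof.
move=> /andP[s0 s1] K0 Kr GK Gs uP t01 au F.
have ur m : modulus (u m) <= r.
  by have := (uP m).1; have := modulus_ge0 (u m); lra.
have uD m : modulus (u m) <= s ^+ m * r.
  apply: le_trans (backward_orbit_decay G r s u m s0 Gs _) _.
    by move=> k; split; [exact: ur|exact: (uP k).2].
  by rewrite ler_wpM2l// exprn_ge0// ltW.
have r0 : 0 <= r by apply: le_trans (ur 0%N); exact: modulus_ge0.
set c := 2 * K * r.
have c0 : 0 <= c by rewrite !mulr_ge0.
(* A bound for the product of the factors 1 + c s^i. Since T <= 2, by 4 K r <= 1 - s, multiplying by
   1 + c s^m adds at most 2 c s^m, which is the increment of [T]. *)
pose T m := 1 + 2 * c * \sum_(i < m) s ^+ i.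
have S0 m : 0 <= \sum_(i < m) s ^+ i.
  by apply: sumr_ge0 => i _; rewrite exprn_ge0// ltW.
have T1 m : 1 <= T m by rewrite lerDl !mulr_ge0.
have T2 m : T m <= 2.
  have s01 : 0 <= s < 1 by rewrite ltW.
  have := sum_geometric_le _ m s01; rewrite -[leRHS]mul1r.
  rewrite ler_pdivlMr ?subr_gt0// => Sm.
  have := S0 m; rewrite /T /c; nra.
suff stab m b v : 0 <= v -> v * T m <= 1 -> modulus (b - u m) <= v * modulus (u m) ->
    (forall k, (k <= m)%N -> modulus (iter k F b) <= r) /\
    modulus (iter m F b - u 0%N) <= v * T m * modulus (u 0%N).
  case/andP: t01 => t0 t1.
  have [|H1 H2] := stab n a t t0 _ au; first by have := T2 n; have := T1 n; nra.
  split => //; apply: le_trans H2 _; rewrite ler_wpM2r ?modulus_ge0//.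
  by rewrite mulrC ler_wpM2r.
elim: m b v => [|m IHm] b v v0 vT bu.
  split; last by rewrite /= /T big_ord0 mulr0 addr0 mulr1.
  move=> k; rewrite leqn0 => /eqP -> /=; have := (uP 0%N).1.
  have := modulusD (b - u 0%N) (u 0%N); rewrite subrK.
  move: vT; rewrite /T big_ord0 mulr0 addr0 mulr1.
  by have := modulus_ge0 (u 0%N); nra.
have v1 : v <= 1 by have := T1 m.+1; nra.
have b2 : modulus b <= 2 * modulus (u m.+1).
  have := modulusD (b - u m.+1) (u m.+1); rewrite subrK.
  by have := modulus_ge0 (u m.+1); nra.
have br : modulus b <= r by apply: le_trans b2 (uP _).1.
have Fb : modulus (F b - u m) <= v * (1 + c * s ^+ m) * modulus (u m).
  set U := modulus (u m.+1).
  have uE : modulus (u m) = U * modulus (G (u m.+1)).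
    by rewrite [in LHS](uP m).2 modulusM.
  have U0 : 0 <= U by exact: modulus_ge0.
  have Uu : U <= modulus (u m).
    rewrite uE ler_peMr//; apply: le_trans (Gs _ (ur _)).
    by rewrite invf_ge1// ltW.
  have Us : U <= s ^+ m * r.
    apply: le_trans (uD _) _; rewrite exprS -mulrA ler_piMl ?(ltW s1)//.
    by rewrite mulr_ge0// exprn_ge0// ltW.
  (* The first summand preserves the relative error v; the second is quadratic in [u m.+1], and its
     decay gives the extra factor c s^m. *)
  have -> : F b - u m =
      (b - u m.+1) * G (u m.+1) + b * (G b - G (u m.+1)).
    by rewrite [in LHS](uP m).2 /F; ring.
  apply: le_trans (modulusD _ _) _; rewrite !modulusM.
  have -> : v * (1 + c * s ^+ m) * modulus (u m) =
     v * modulus (u m) + 2 * (s ^+ m * r) * (K * (v * modulus (u m))).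
    by rewrite /c; ring.
  apply: lerD; first by rewrite uE mulrA ler_wpM2r ?modulus_ge0.
  apply: (@le_trans _ _ ((2 * U) * (K * (v * U)))).
    rewrite ler_pM ?modulus_ge0//; apply: le_trans (GK _ _ br (ur _)) _.
    by rewrite ler_wpM2l.
  rewrite ler_pM ?mulr_ge0 ?ler_wpM2l//.
have cs0 : 0 <= c * s ^+ m by rewrite mulr_ge0// exprn_ge0// ltW.
have TS : (1 + c * s ^+ m) * T m <= T m.+1.
  have -> : T m.+1 = T m + 2 * (c * s ^+ m).
    by rewrite /T big_ord_recr /=; ring.
  by rewrite mulrDl mul1r lerD2l mulrC ler_wpM2r.
have vTS : v * (1 + c * s ^+ m) * T m <= v * T m.+1 by rewrite -mulrA ler_wpM2l.
have v'0 : 0 <= v * (1 + c * s ^+ m) by rewrite mulr_ge0// addr_ge0.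
have [Fr Fy] := IHm (F b) _ v'0 (le_trans vTS vT) Fb.
split=> [[|k] km //|]; first by rewrite iterSr Fr.
by rewrite iterSr (le_trans Fy)// ler_wpM2r ?modulus_ge0.
Qed.

(** Multiplication by d = mu^N nu^M is a homeomorphism, so approximating c / d by some product
    approximates c by one with large exponents. *)
Lemma powers_dense_tail (mu nu c : C) (N M : nat) (e : R) : mu != 0 -> nu != 0 ->
  closure [set x : C | exists n m : nat, x = mu ^+ n * nu ^+ m] = [set: C] ->
  0 < e -> exists n m, [/\ (N <= n)%N, (M <= m)%N &
    modulus (mu ^+ n * nu ^+ m - c) < e].
Proof.
move=> mu0 nu0 dns e0; set d := mu ^+ N * nu ^+ M.
have d0 : d != 0 by rewrite mulf_neq0// expf_neq0.
have md0 : 0 < modulus d by rewrite modulus_gt0.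
have cl : closure [set x : C | exists n m : nat, x = mu ^+ n * nu ^+ m] (c / d).
  by rewrite dns.
have [_ [n [m ->]] nm] := closure_modulusP _ _ cl _ (divr_gt0 e0 md0).
exists (N + n)%N, (M + m)%N; rewrite !leq_addr; split => //.
have -> : mu ^+ (N + n) * nu ^+ (M + m) - c = d * (mu ^+ n * nu ^+ m - c / d).
  by rewrite /d !exprD; field; rewrite !expf_neq0.
by rewrite modulusM mulrC -ltr_pdivlMr.
Qed.

(** With q = mu^n nu^m one has mu^n (x m - u n) = q phi m - w n. Both [phi] and [w] stabilize
    relatively, so choosing q near w N / phi M makes [x m] close to [u n] relative to |u n|, and
    [backward_orbit_stable] carries this to [u 0]. *)
Lemma two_germs_orbit_near G0 G1 r K s (u : nat -> C) z (d : R) :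
  0 < s < 1 -> 0 <= K -> 4 * K * r <= 1 - s ->
  (forall z w, modulus z <= r -> modulus w <= r ->
     modulus (G0 z - G0 w) <= K * modulus (z - w)) ->
  (forall z w, modulus z <= r -> modulus w <= r ->
     modulus (G1 z - G1 w) <= K * modulus (z - w)) ->
  (forall z, modulus z <= r -> s^-1 <= modulus (G0 z)) ->
  (forall z, modulus z <= r -> G1 z != 0 /\ modulus (G1 z) <= s) ->
  closure [set x : C | exists n m : nat, x = G0 0 ^+ n * G1 0 ^+ m] = [set: C] ->
  (forall n, 2 * modulus (u n) <= r /\ u n = u n.+1 * G0 (u n.+1)) ->
  u 0%N != 0 -> z != 0 -> modulus z <= r -> 0 < d ->
  exists n m, [/\ (0 < n)%N,
    forall k, (k <= m)%N -> modulus (iter k (fun w => w * G1 w) z) <= r,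
    forall k, (k <= n)%N ->
      modulus (iter k (fun w => w * G0 w) (iter m (fun w => w * G1 w) z)) <= r &
    modulus (iter n (fun w => w * G0 w) (iter m (fun w => w * G1 w) z) - u 0%N)
      <= d].
Proof.
move=> s01 K0 Kr GK0 GK1 Gs0 Gs1 dns uP u0 z0 zr d0.
have /andP[s0 s1] := s01.
have r0 : 0 <= r by apply: le_trans zr; exact: modulus_ge0.
have m0 : modulus (0 : C) <= r by rewrite modulus0.
set mu := G0 0 in dns *; set nu := G1 0 in dns *.
have G0n w : modulus w <= r -> G0 w != 0.
  move=> /Gs0; rewrite -modulus_gt0; apply: lt_le_trans.
  by rewrite invr_gt0.
have mu0 : mu != 0 by exact: G0n.
have nu0 : nu != 0 by have [] := Gs1 _ m0.
pose x m := iter m (fun w => w * G1 w) z.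
have xD m : modulus (x m) <= s ^+ m * r.
  apply: le_trans (forward_orbit_decay G1 r s z m _ _ zr) _.
  - by rewrite (ltW s0) (ltW s1).
  - by move=> w /Gs1[].
  - by rewrite ler_wpM2l// exprn_ge0// ltW.
have xr m : modulus (x m) <= r.
  by apply: le_trans (xD _) _; rewrite ler_piMl// exprn_ile1// ltW.
have ur m : modulus (u m) <= r.
  by have := (uP m).1; have := modulus_ge0 (u m); lra.
have uD m : modulus (u m) <= s ^+ m * r.
  apply: le_trans (backward_orbit_decay G0 r s u m s0 Gs0 _) _.
    by move=> k; split; [exact: ur|exact: (uP k).2].
  by rewrite ler_wpM2l// exprn_ge0// ltW.
have xn0 m : x m != 0.
  by elim: m => [//|m IHm]; rewrite /x iterS mulf_neq0//; have [] := Gs1 _ (xr m).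
have un0 m : u m != 0.
  elim: m => [//|m]; apply: contraNneq => um.
  by rewrite (uP m).2 um mul0r.
pose t := Num.min (1 / 2) (d / (2 * modulus (u 0%N))).
have mu00 : 0 < modulus (u 0%N) by rewrite modulus_gt0.
have t0 : 0 < t by rewrite lt_min !divr_gt0// mulr_gt0.
have t2 : t <= 1 / 2 by rewrite ge_min lexx.
have td : 2 * t * modulus (u 0%N) <= d.
  rewrite mulrAC -ler_pdivlMl ?mulr_gt0// mulrC.
  by rewrite ge_min lexx orbT.
(* The three errors below add up to (3 + eta) eta |w N|, and |w N| <= (1 + 2 eta) |w n|; as eta <=
   1/16 the total is at most 8 eta |w n|. *)
pose eta := t / 8.
have eta0 : 0 < eta by rewrite divr_gt0.
have s01' : 0 <= s < 1 by rewrite (ltW s0).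
pose phi m := x m / nu ^+ m; pose w n := mu ^+ n * u n.
have [M phiM] : exists M, forall m, (M <= m)%N ->
    modulus (phi m - phi M) <= eta * modulus (phi M).
  (* The quotient of consecutive terms is G1 (x m) / nu; it differs from 1 by at most K |x m| /
     |nu|, and |x m| <= s^m r. For [w] it is mu / G0 (u n.+1). *)
  apply: (relative_cauchy phi (fun m => G1 (x m) / nu - 1)
    (K * r / modulus nu) s) => // [|m|m].
  - by rewrite mulr_ge0 ?invr_ge0 ?modulus_ge0// mulr_ge0.
  - by rewrite addrC subrK /phi /x iterS exprS; field; rewrite nu0 expf_neq0.
  have -> : G1 (x m) / nu - 1 = (G1 (x m) - nu) / nu by field.
  rewrite modulusM modulusV mulrAC ler_wpM2r ?invr_ge0 ?modulus_ge0//.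
  apply: le_trans (GK1 _ _ (xr m) m0) _; rewrite subr0 -mulrA ler_wpM2l//.
  by rewrite mulrC.
have [N wN] : exists N, forall n, (N <= n)%N ->
    modulus (w n - w N) <= eta * modulus (w N).
  apply: (relative_cauchy w (fun n => mu / G0 (u n.+1) - 1) (K * r) s) => //.
  - by rewrite mulr_ge0.
  - move=> n; rewrite addrC subrK /w [u n in RHS](uP n).2 exprS.
    by field; exact: G0n.
  move=> n; have Gn := G0n _ (ur n.+1).
  have -> : mu / G0 (u n.+1) - 1 = (mu - G0 (u n.+1)) / G0 (u n.+1) by field.
  rewrite modulusM modulusV ler_pdivrMr ?modulus_gt0//.
  have G1le : 1 <= modulus (G0 (u n.+1)).
    by apply: le_trans (Gs0 _ (ur _)); rewrite invf_ge1// ltW.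
  apply: (@le_trans _ _ (K * r * s ^+ n)); last first.
    by rewrite ler_peMr// !mulr_ge0// exprn_ge0// ltW.
  apply: le_trans (GK0 _ _ m0 (ur n.+1)) _.
  rewrite sub0r modulusN -mulrA ler_wpM2l// mulrC (le_trans (uD _))//.
  by rewrite exprS -mulrA ler_piMl ?(ltW s1)// mulr_ge0// exprn_ge0// ltW.
have phin0 m : phi m != 0 by rewrite mulf_neq0// invr_eq0 expf_neq0.
have wn0 n : w n != 0 by rewrite mulf_neq0// expf_neq0.
have wM0 : 0 < modulus (w N) by rewrite modulus_gt0.
have pM0 : 0 < modulus (phi M) by rewrite modulus_gt0.
have e0 : 0 < eta * modulus (w N) / modulus (phi M).
  by rewrite divr_gt0// mulr_gt0.
(* [N.+1] rather than N makes n positive, as the semigroup has no identity. *)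
have [n [m [Nn Mm nmP]]] :=
  powers_dense_tail _ _ (w N / phi M) N.+1 M _ mu0 nu0 dns e0.
exists n, m; rewrite (leq_trans _ Nn)//.
set q := mu ^+ n * nu ^+ m in nmP.
have qP : modulus (q * phi M - w N) <= eta * modulus (w N).
  have -> : q * phi M - w N = (q - w N / phi M) * phi M by field.
  by rewrite modulusM -ler_pdivlMr// ltW.
have qM : modulus q * modulus (phi M) <= (1 + eta) * modulus (w N).
  rewrite -modulusM; have := modulusD (q * phi M - w N) (w N).
  by rewrite subrK mulrDl mul1r; lra.
have close : modulus (x m - u n) <= t * modulus (u n).
  rewrite -(@ler_pM2l _ (modulus (mu ^+ n))) ?modulus_gt0 ?expf_neq0//.
  rewrite mulrCA -!modulusM -/(w n).
  have -> : mu ^+ n * (x m - u n) =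
     q * (phi m - phi M) + (q * phi M - w N) + (w N - w n).
    by rewrite /q /phi /w; field; rewrite !expf_neq0.
  apply: le_trans (modulusD _ _) _.
  have := modulusD (q * (phi m - phi M)) (q * phi M - w N).
  rewrite modulusM (modulus_distC (w N)).
  have h1 := phiM _ Mm; have h2 := wN _ (ltnW Nn).
  have h3 : modulus q * modulus (phi m - phi M) <=
      (1 + eta) * eta * modulus (w N).
    apply: (@le_trans _ _ (modulus q * (eta * modulus (phi M)))).
      by rewrite ler_wpM2l// modulus_ge0.
    rewrite mulrCA [leRHS](_ : _ = eta * ((1 + eta) * modulus (w N))); last by ring.
    by rewrite ler_wpM2l// ltW.
  have h4 : modulus (w N) <= (1 + 2 * eta) * modulus (w n).
    have := modulusD (w N - w n) (w n); rewrite subrK modulus_distC => h5.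
    have he : eta <= 1 / 16 by rewrite /eta; lra.
    have h6 : (1 - eta) * modulus (w N) <= modulus (w n) by lra.
    have : (1 + 2 * eta) * ((1 - eta) * modulus (w N)) <= (1 + 2 * eta) * modulus (w n).
      by apply: ler_wpM2l => //; lra.
    have : 0 <= eta * (1 - 2 * eta) * modulus (w N).
      by rewrite !mulr_ge0 ?modulus_ge0 ?(ltW eta0)//; lra.
    lra.
  move=> h5; apply: (@le_trans _ _ ((3 + eta) * eta * modulus (w N))); first lra.
  apply: (@le_trans _ _ ((3 + eta) * eta * ((1 + 2 * eta) * modulus (w n)))).
    by rewrite ler_wpM2l// mulr_ge0 ?addr_ge0// ltW.
  rewrite mulrA ler_wpM2r ?modulus_ge0//.
  have -> : t = 8 * eta by rewrite /eta; field.
  have he : eta <= 1 / 16 by rewrite /eta; lra.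
  nra.
have t02 : 0 <= t <= 1 / 2 by rewrite (ltW t0).
have [fr fu] := backward_orbit_stable _ _ _ _ _ _ _ _ s01 K0 Kr GK0 Gs0 uP t02 close.
by split=> // [k _|]; [exact: xr|exact: le_trans fu td].
Qed.

End Linearization.

(** * Rational maps: Lipschitz germs, local preimages, homogeneous coordinates *)

Section RationalMaps.
Context {R : realType}.
Local Notation C := (Cplx R).
Local Notation S := (sphere R).
Implicit Types (x y z w : C) (p q P Q : {poly C}) (r K : R).

Lemma poly_lipschitz p : exists2 L : R, 0 <= L & forall z w,
  modulus z <= 1 -> modulus w <= 1 ->
  modulus (p.[z] - p.[w]) <= L * modulus (z - w).
Proof.
elim/poly_ind: p => [|p c [L L0 pL]].
  by exists 0 => // z w _ _; rewrite !horner0 subrr modulus0 mul0r.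
have [M M0 pM] := poly_disc_bounded _ p (@ler01 R).
exists (L + M) => [|z w z1 w1]; first by rewrite addr_ge0// ltW.
have -> : (p * 'X + c%:P).[z] - (p * 'X + c%:P).[w] =
    (p.[z] - p.[w]) * z + p.[w] * (z - w) by rewrite !hornerMXaddC; ring.
apply: le_trans (modulusD _ _) _; rewrite !modulusM mulrDl lerD//.
  rewrite -[leRHS]mulr1 ler_pM ?modulus_ge0//; exact: pL.
by rewrite ler_wpM2r ?modulus_ge0// pM.
Qed.

Lemma ratfun_lipschitz p q : q.[0] != 0 -> exists r K, [/\ 0 < r, 0 <= K,
  forall z, modulus z <= r -> q.[z] != 0 &
  forall z w, modulus z <= r -> modulus w <= r ->
    modulus (p.[z] / q.[z] - p.[w] / q.[w]) <= K * modulus (z - w)].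
Proof.
move=> q0; have mq0 : 0 < modulus q.[0] by rewrite modulus_gt0.
have [Lp Lp0 pL] := poly_lipschitz p; have [Lq Lq0 qL] := poly_lipschitz q.
have [Mp Mp0 pM] := poly_disc_bounded _ p (@ler01 R).
have [Mq Mq0 qM] := poly_disc_bounded _ q (@ler01 R).
(* On this disc the denominator varies by at most Lq r <= |q.[0]| / 2, so it keeps at least half of
   its modulus at 0. *)
pose r := Num.min 1 (modulus q.[0] / (2 * (Lq + 1))).
have Lq1 : 0 < 2 * (Lq + 1) by rewrite mulr_gt0// ltr_wpDl.
have r0 : 0 < r by rewrite lt_min ltr01 divr_gt0.
have r1 : r <= 1 by rewrite ge_min lexx.
have rq : r * (2 * (Lq + 1)) <= modulus q.[0].
  by rewrite -ler_pdivlMr// ge_min lexx orbT.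
have qge z : modulus z <= r -> modulus q.[0] / 2 <= modulus q.[z].
  move=> zr; have z1 := le_trans zr r1.
  have := qL 0 z; rewrite modulus0 sub0r modulusN => /(_ ler01 z1).
  have := modulusD (q.[0] - q.[z]) q.[z]; rewrite subrK.
  have : Lq * modulus z <= Lq * r by rewrite ler_wpM2l.
  lra.
have qn0 z : modulus z <= r -> q.[z] != 0.
  by move=> /qge h; rewrite -modulus_gt0; apply: lt_le_trans h; rewrite divr_gt0.
exists r, ((Lp * Mq + Mp * Lq) / (modulus q.[0] / 2) ^+ 2); split => //.
  by rewrite divr_ge0 ?exprn_ge0// ?addr_ge0 ?mulr_ge0 ?divr_ge0 ?modulus_ge0// ltW.
move=> z w zr wr; have z1 := le_trans zr r1; have w1 := le_trans wr r1.
have [qz qw] := (qn0 _ zr, qn0 _ wr).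
have -> : p.[z] / q.[z] - p.[w] / q.[w] =
    ((p.[z] - p.[w]) * q.[w] + p.[w] * (q.[w] - q.[z])) / (q.[z] * q.[w]).
  by field; rewrite qz qw.
rewrite modulusM modulusV (mulrAC _ _ (modulus (z - w))).
rewrite ler_pM ?modulus_ge0 ?invr_ge0 ?modulus_ge0//.
  apply: le_trans (modulusD _ _) _; rewrite !modulusM mulrDl lerD//.
    by rewrite mulrAC ler_pM ?modulus_ge0 ?pL ?qM.
  by rewrite -mulrA ler_pM ?modulus_ge0 ?pM// modulus_distC qL.
rewrite lef_pV2 ?posrE ?exprn_gt0 ?divr_gt0// ?modulus_gt0 ?mulf_neq0//.
by rewrite modulusM expr2 ler_pM ?qge// divr_ge0 ?modulus_ge0.
Qed.

Lemma deriv_at_fixed_fin0 (f : S -> S) (G : C -> C) r K : 0 < r ->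
  (forall z, modulus z <= r -> f (fin z) = fin (z * G z)) ->
  (forall z, modulus z <= r -> modulus (G z - G 0) <= K * modulus z) ->
  deriv_at f (fin 0) = G 0.
Proof.
move=> r0 fG GK; rewrite /deriv_at /derive1.
have f0 : f (fin 0) = fin 0 by rewrite fG ?mul0r// modulus0 ltW.
have fE z : modulus z <= r -> in_charts f (fin 0) z = z * G z.
  by move=> zr; rewrite /in_charts f0 /= add0r fG//= subr0.
apply: cvg_lim => // A /nbhs_modulusP[e e0 eA].
apply/nbhs_modulusP; exists (Num.min r (e / (`|K| + 1))).
  by rewrite lt_min r0 divr_gt0// ltr_wpDl.
move=> h; rewrite subr0 lt_min => /andP[/ltW hr he] h0 /=; apply: eA.
rewrite addr0 !fE ?modulus0 ?(ltW r0)// mul0r subr0 /GRing.scale /= mulKf//.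
apply: le_lt_trans (GK _ hr) _; rewrite ltr_pdivlMr ?ltr_wpDl// in he.
have := ler_norm K; have := modulus_ge0 h; nra.
Qed.

(** The logarithmic derivative at 0 is minus the sum of the inverses of the roots, each at most 1 /
    d in modulus. The induction on linear factors proves this without division. *)
Lemma poly_roots_far p (d : R) : 0 < d -> p != 0 ->
  (forall z, root p z -> d <= modulus z) ->
  modulus p`_1 * d <= (size p)%:R * modulus p`_0.
Proof.
move=> d0 p0 pd; have [s pE] := Cplx_poly_normal p.
have c0 : lead_coef p != 0 by rewrite lead_coef_eq0.
have sd : {in s, forall z, d <= modulus z}.
  by move=> z zs; apply: pd; rewrite pE rootZ// root_prod_XsubC.
have -> : size p = (size s).+1 by rewrite pE size_scale// size_prod_XsubC.
rewrite pE !coefZ !modulusM mulrCA -mulrA ler_wpM2l ?modulus_ge0//.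
elim: s sd {pE} => [|z s IHs] sd.
  by rewrite big_nil !coef1 /= modulus0 mul0r mul1r modulus_ge0.
have sd' : {in s, forall w, d <= modulus w}.
  by move=> w ws; apply: sd; rewrite in_cons ws orbT.
have {}IHs := IHs sd'.
have zd : d <= modulus z by apply: sd; rewrite mem_head.
rewrite big_cons; set Q := \prod_(w <- s) _ in IHs *.
rewrite mulrBl !coefB !coefXM !coefCM /= sub0r modulusN modulusM.
have -> : (size s).+2%:R = (size s).+1%:R + 1 :> R by rewrite -natr1.
apply: (@le_trans _ _ ((modulus Q`_0 + modulus z * modulus Q`_1) * d)).
  rewrite ler_wpM2r ?(ltW d0)// (le_trans (modulusB _ _))//.
  by rewrite modulusM.
have Q0 := modulus_ge0 Q`_0; have z0 := modulus_ge0 z.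
have : modulus z * (modulus Q`_1 * d) <=
   modulus z * ((size s).+1%:R * modulus Q`_0) by rewrite ler_wpM2l.
have : d * modulus Q`_0 <= modulus z * modulus Q`_0 by rewrite ler_wpM2r.
lra.
Qed.

(** If p - y q had no root of modulus at most d, its linear coefficient, close to [p]_1[, would be
    controlled by its constant one, which is -y]q[_0] and tends to 0 with y. *)
Lemma small_preimage p q (d : R) : 0 < d -> p`_0 = 0 -> p`_1 != 0 ->
  exists2 r : R, 0 < r & forall y, modulus y <= r ->
    exists2 u, modulus u <= d & p.[u] = y * q.[u].
Proof.
move=> d0 p00 p1.
have mp1 : 0 < modulus p`_1 by rewrite modulus_gt0.
pose N : R := (maxn (size p) (size q)).+1%:R.
have N0 : 0 < N by rewrite ltr0n.
have q1 : 0 < 2 * (modulus q`_1 + 1) by rewrite mulr_gt0// ltr_wpDl// modulus_ge0.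
have q0 : 0 < 4 * N * (modulus q`_0 + 1).
  by rewrite !mulr_gt0// ltr_wpDl// modulus_ge0.
pose r := Num.min (modulus p`_1 / (2 * (modulus q`_1 + 1)))
                  (modulus p`_1 * d / (4 * N * (modulus q`_0 + 1))).
have r1 : r * (2 * (modulus q`_1 + 1)) <= modulus p`_1.
  by rewrite -ler_pdivlMr// ge_min lexx.
have r2 : r * (4 * N * (modulus q`_0 + 1)) <= modulus p`_1 * d.
  by rewrite -ler_pdivlMr// ge_min lexx orbT.
have r0 : 0 < r by rewrite lt_min !divr_gt0// mulr_gt0.
exists r => // y yr; apply: contrapT => no_root.
pose P := p - y *: q.
have P0 : modulus P`_0 <= r * modulus q`_0.
  by rewrite coefB coefZ p00 sub0r modulusN modulusM ler_wpM2r ?modulus_ge0.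
have P1 : modulus p`_1 / 2 <= modulus P`_1.
  have := modulusD P`_1 (y * q`_1); rewrite {1}coefB coefZ subrK modulusM.
  have : modulus y * modulus q`_1 <= r * modulus q`_1.
    by rewrite ler_wpM2r ?modulus_ge0.
  lra.
have Pn0 : P != 0.
  apply: contraTneq P1 => ->; rewrite coef0 modulus0 -ltNge.
  by rewrite divr_gt0.
have Pd z : root P z -> d <= modulus z.
  rewrite /root !hornerE subr_eq0 => /eqP pz; rewrite leNgt; apply/negP => zd.
  by apply: no_root; exists z => //; exact: ltW.
have := poly_roots_far _ _ d0 Pn0 Pd.
have sP : (size P)%:R <= N.
  rewrite ler_nat; apply: leqW; apply: leq_trans (size_polyD _ _) _.
  rewrite size_polyN geq_max leq_maxl /=.
  by apply: leq_trans (size_scale_leq _ _) _; rewrite leq_maxr.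
have : (size P)%:R * modulus P`_0 <= N * (r * modulus q`_0).
  by rewrite ler_pM ?modulus_ge0.
have : modulus p`_1 / 2 * d <= modulus P`_1 * d by rewrite ler_wpM2r// ltW.
have : 0 <= N * r * modulus q`_0 by rewrite !mulr_ge0 ?modulus_ge0// ltW.
have : 0 < N * r by rewrite mulr_gt0.
have : 0 < modulus p`_1 * d by rewrite mulr_gt0.
lra.
Qed.

(** The point [a : b] of the projective line. The pair (0, 0) would give [infty]; it is excluded by
    the conditions carried along. *)
Definition proj_point (a b : C) : S := if b == 0 then infty R else fin (a / b).

(** The degree-d homogenization of p evaluated at (P, Q), that is Q^d p(P / Q) cleared of
    denominators. *)
Definition homog (d : nat) p P Q : {poly C} :=
  \sum_(i < d.+1) p`_i *: (P ^+ i * Q ^+ (d - i)).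

Lemma homogE d p P Q z : (size p <= d.+1)%N ->
  (homog d p P Q).[z] =
    if Q.[z] == 0 then p`_d * P.[z] ^+ d else Q.[z] ^+ d * p.[P.[z] / Q.[z]].
Proof.
move=> pd; rewrite horner_sum.
under eq_bigr do rewrite hornerZ hornerM !horner_exp.
case: ifPn => [/eqP ->|Qz].
  rewrite big_ord_recr /= subnn mulr1 big1 ?add0r// => i _.
  by rewrite expr0n subn_eq0 leqNgt ltn_ord !mulr0.
rewrite (horner_coef_wide _ pd) mulr_sumr; apply: eq_bigr => i _.
have -> : Q.[z] ^+ d = Q.[z] ^+ (d - i) * Q.[z] ^+ i.
  by rewrite -exprD subnK// -ltnS.
by rewrite expr_div_n; field; rewrite expf_neq0.
Qed.

(** The new pair has no common zero for two reasons: where Q is nonzero by coprimality, and where Q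
    vanishes because d is the larger degree, so [p]_d[or]q[_d] is nonzero. *)
Lemma ratmap_homog p q P Q : q != 0 -> coprimep p q ->
  (forall z, (P.[z] != 0) || (Q.[z] != 0)) ->
  let d := (maxn (size p) (size q)).-1 in
  forall z,
    ((homog d p P Q).[z] != 0) || ((homog d q P Q).[z] != 0) /\
    ratmap p q (proj_point P.[z] Q.[z]) =
      proj_point (homog d p P Q).[z] (homog d q P Q).[z].
Proof.
move=> q0 pq PQ d z.
have dE : d.+1 = maxn (size p) (size q).
  by rewrite prednK// leq_max !size_poly_gt0 q0 orbT.
have [pd qd] : (size p <= d.+1)%N /\ (size q <= d.+1)%N.
  by rewrite dE leq_maxl leq_maxr.
rewrite !homogE// /proj_point; case: ifPn => [Qz|Qz].
  have Pz : P.[z] ^+ d != 0.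
    by have := PQ z; rewrite Qz orbF => Pz; rewrite expf_neq0.
  rewrite /ratmap /infty /=; case: ifPn => [qp|].
    have dp : d = (size p).-1 by rewrite /d (maxn_idPl (ltnW qp)).
    have -> : q`_d = 0 by rewrite nth_default// dp; case: (size p) qp.
    rewrite mul0r eqxx /= orbF mulf_neq0// dp -lead_coefE lead_coef_eq0.
    by rewrite -size_poly_gt0; case: (size p) qp.
  rewrite -leqNgt => pq_size.
  have dq : d = (size q).-1 by rewrite /d (maxn_idPr pq_size).
  have qd0 : q`_d != 0 by rewrite dq -lead_coefE lead_coef_eq0.
  rewrite (negPf (mulf_neq0 qd0 Pz)) orbT; split => //; congr fin.
  by rewrite lead_coefE -dq; field; rewrite qd0 Pz.
have Qd : Q.[z] ^+ d != 0 by rewrite expf_neq0.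
rewrite /ratmap /fin !mulf_eq0 !(negPf Qd) /=; split.
  rewrite -negb_and; apply/andP => -[/eqP/rootP/(coprimep_root pq)].
  by move=> /negPf ->.
case: ifPn => // qz; congr Some.
by field; rewrite qz Qd.
Qed.

Lemma iter_ratmap_homog p q n : q != 0 -> coprimep p q ->
  exists P Q : {poly C}, forall z, (P.[z] != 0) || (Q.[z] != 0) /\
    iter n (ratmap p q) (fin z) = proj_point P.[z] Q.[z].
Proof.
move=> q0 pq; elim: n => [|n [P [Q PQ]]].
  exists 'X, 1 => z; rewrite !hornerE /proj_point oner_neq0 orbT.
  by rewrite (negPf (oner_neq0 _)) divr1.
have PQ0 z := (PQ z).1.
exists (homog (maxn (size p) (size q)).-1 p P Q).
exists (homog (maxn (size p) (size q)).-1 q P Q) => z.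
have [H1 H2] := ratmap_homog _ _ _ _ q0 pq PQ0 z.
by split => //; rewrite iterS (PQ z).2.
Qed.

(* Otherwise 1 / (f^n - v) is holomorphic on |z| <= r and bounded by 1 / e,
   uniformly in n, yet takes the distinct values -1 / v at 0 and 1 / (y - v) at
   u n, which tends to 0. *)
Lemma iterates_hit_ball p q r (s e : R) (u : nat -> C) y v :
  q != 0 -> coprimep p q -> ratmap p q (fin 0) = fin 0 ->
  0 < r -> 0 <= s < 1 -> (forall n, modulus (u n) <= s ^+ n * r) ->
  (forall n, iter n (ratmap p q) (fin (u n)) = fin y) -> y != 0 ->
  v != 0 -> 0 < e ->
  exists n x b, [/\ modulus x <= r, iter n (ratmap p q) (fin x) = fin b &
    modulus (b - v) < e].
Proof.
move=> q0 pq f0 r0 s01 us uy y0 v0 e0.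
apply: contrapT => no_hit; set f := ratmap p q in f0 uy no_hit *.
have far n x b : modulus x <= r -> iter n f (fin x) = fin b ->
    e <= modulus (b - v).
  move=> xr xb; rewrite leNgt; apply/negP => bv.
  by apply: no_hit; exists n, x, b.
have ur n : modulus (u n) <= r.
  have /andP[s0 s1] := s01.
  apply: le_trans (us n) _; rewrite ler_piMl ?(ltW r0)//.
  by rewrite exprn_ile1// ltW.
(* Case n = 0 of [far]: [u 0] is [y] itself. *)
have yv : y - v != 0.
  by rewrite -modulus_gt0; apply: lt_le_trans (far 0%N _ _ (ur 0%N) (uy 0%N)).
pose c := modulus (y / (v * (y - v))).
have c0 : 0 < c by rewrite modulus_gt0 !mulf_neq0// invr_eq0 mulf_neq0.
(* The 1/2 puts [u n] in the half disc where the Schwarz inequality holds; c e / 4 makes its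
   right-hand side at most c / 2, while c is the actual difference of the two values. *)
have ce0 : 0 < Num.min (1 / 2) (c * e / 4).
  by rewrite lt_min !divr_gt0// mulr_gt0.
have [n /(_ n (leqnn n))] := exprn_small _ _ s01 ce0.
rewrite le_min => /andP[n2 nc].
have [P [Q PQ]] := iter_ratmap_homog p q n q0 pq.
(* 1 / (f^n - v) is Q / D, which simply takes the value 0 at the poles of f^n. *)
pose D := P - v *: Q.
have DE z : D.[z] = P.[z] - v * Q.[z] by rewrite !hornerE.
have D_ge z : modulus z <= r -> D.[z] != 0 /\ e * modulus Q.[z] <= modulus D.[z].
  move=> zr; have [PQz] := PQ z; rewrite DE /proj_point.
  have [Qz|Qz] := eqVneq Q.[z] 0.
    rewrite Qz eqxx orbF in PQz.
    by rewrite Qz !mulr0 subr0 modulus0 mulr0 modulus_ge0 PQz.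
  move=> /(far _ _ _ zr) ev.
  have -> : P.[z] - v * Q.[z] = (P.[z] / Q.[z] - v) * Q.[z] by field.
  have mQ : 0 < modulus Q.[z] by rewrite modulus_gt0.
  rewrite modulusM ler_wpM2r ?modulus_ge0// mulf_neq0//.
  by rewrite -modulus_gt0; apply: lt_le_trans ev.
have bound z : modulus z <= r -> modulus (Q.[z] / D.[z]) <= e^-1.
  move=> /D_ge[Dz eD]; rewrite modulusM modulusV.
  by rewrite ler_pdivrMr ?modulus_gt0// ler_pdivlMl.
have un : modulus (u n) <= r / 2.
  by apply: le_trans (us n) _; rewrite mulrC ler_wpM2l ?(ltW r0)// -div1r.
have value z b : iter n f (fin z) = fin b -> b - v != 0 ->
    Q.[z] / D.[z] = (b - v)^-1.
  move=> + bv; rewrite (PQ z).2 /proj_point DE; case: ifPn => // Qz [bE].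
  rewrite -bE in bv *.
  have -> : P.[z] - v * Q.[z] = (P.[z] / Q.[z] - v) * Q.[z] by field.
  by rewrite invfM mulrCA mulfV ?mulr1.
have fn0 : iter n f (fin 0) = fin 0.
  by elim: (n) => [//|k IHk]; rewrite iterS IHk.
have := ratfun_schwarz _ _ Q D _ r0 (fun z zr => (D_ge z zr).1) bound un.
rewrite (value _ _ (uy n) yv) (value _ _ fn0) ?sub0r ?oppr_eq0//.
have -> : (y - v)^-1 - (- v)^-1 = y / (v * (y - v)).
  by field; rewrite yv v0.
rewrite -/c leNgt => /negP; apply.
rewrite ltr_pdivrMr// -!mulrA.
apply: (@le_lt_trans _ _ (2 * (e^-1 * (c * e / 4 * r)))).
  rewrite ler_wpM2l// ler_wpM2l ?invr_ge0 ?(ltW e0)//.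
  by apply: le_trans (us n) _; rewrite ler_wpM2r// ltW.
have -> : 2 * (e^-1 * (c * e / 4 * r)) = c * r / 2 by field; rewrite gt_eqF.
by have : 0 < c * r; [rewrite mulr_gt0|lra].
Qed.

End RationalMaps.

(** * From density near 0 to density in the sphere *)

Section DenseOrbits.
Context {R : realType}.
Local Notation C := (Cplx R).
Local Notation S := (sphere R).
Implicit Types (x y z w : C) (p q : {poly C}) (r K : R).

(** Since the numerator vanishes at 0 it is g X, and G = g / q; its linear coefficient g(0) is
    nonzero when G 0 is, which yields small preimages. *)
Lemma ratmap_germ p q : ratmap p q (fin 0) = fin 0 ->
  exists (G : C -> C) (r K : R), [/\ 0 < r, 0 <= K, deriv_at (ratmap p q) (fin 0) = G 0,
    forall z, modulus z <= r -> ratmap p q (fin z) = fin (z * G z) &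
    forall z w, modulus z <= r -> modulus w <= r ->
      modulus (G z - G w) <= K * modulus (z - w)] /\
  (G 0 != 0 -> forall d : R, 0 < d <= r -> exists2 r' : R, 0 < r' &
    forall y, modulus y <= r' -> exists2 u, modulus u <= d & u * G u = y).
Proof.
rewrite [ratmap p q (fin 0)]/=; case: ifPn => // q0 [] /eqP.
rewrite mulf_eq0 invr_eq0 (negPf q0) orbF => /factor_theorem[g].
rewrite subr0 => ->.
have [r [K [r0 K0 qr gK]]] := ratfun_lipschitz g q q0.
have fG z : modulus z <= r ->
    ratmap (g * 'X) q (fin z) = fin (z * (g.[z] / q.[z])).
  by move=> /qr qz; rewrite /= (negPf qz) hornerMX mulrAC mulrC.
exists (fun z => g.[z] / q.[z]), r, K; split.
  split => //; apply: (deriv_at_fixed_fin0 _ (fun z => g.[z] / q.[z]) r K) => // z zr.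
  by have := gK z 0 zr; rewrite subr0; apply; rewrite modulus0 ltW.
move=> g0 d /andP[d0 dr].
have c0 : (g * 'X)`_0 = 0 by rewrite coefMX.
have c1 : (g * 'X)`_1 != 0.
  rewrite coefMX /= -horner_coef0; apply: contraNneq g0 => ->.
  by rewrite mul0r.
have [r' r'0 r'P] := small_preimage _ q _ d0 c0 c1.
exists r' => // y /r'P[u ud pu]; exists u => //.
have qu : q.[u] != 0 by apply: qr; exact: le_trans dr.
by rewrite hornerMX in pu; rewrite mulrA [u * _]mulrC pu mulfK.
Qed.

Lemma iter_fin (f : S -> S) (F : C -> C) r (a : C) n :
  (forall z, modulus z <= r -> f (fin z) = fin (F z)) ->
  (forall k, (k < n)%N -> modulus (iter k F a) <= r) ->
  iter n f (fin a) = fin (iter n F a).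
Proof.
move=> fF; elim: n => [//|n IHn] Fa.
by rewrite !iterS IHn ?fF ?Fa// => k kn; apply: Fa; exact: ltnW.
Qed.

(** Grouping one [f0] with [iter m f1] avoids the identity, which would appear for m = 0. *)
Lemma semigroup_iter (f0 f1 : S -> S) n m : (0 < n)%N ->
  semigroup f0 f1 (iter n f0 \o iter m f1).
Proof.
move=> n0; have iter0 g : semigroup f0 f1 g -> semigroup f0 f1 (iter n.-1 f0 \o g).
  move=> gP; elim: n.-1 => [//|k IHk].
  exact: semigroup_comp (semigroup_gen0 _ _) IHk.
have iter1 k : semigroup f0 f1 (iter k.+1 f1).
  elim: k => [|k IHk]; first exact: semigroup_gen1.
  exact: semigroup_comp (semigroup_gen1 _ _) IHk.
have -> : iter n f0 \o iter m f1 = iter n.-1 f0 \o (f0 \o iter m f1).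
  by apply/funext => x /=; rewrite -iterSr prednK.
apply: iter0; case: m => [|m]; first exact: semigroup_gen0.
exact: semigroup_comp (semigroup_gen0 _ _) (iter1 _).
Qed.

Lemma exists_germ_radius (G0 G1 : C -> C) (r0 K : R) : 0 < r0 -> 0 <= K ->
  (forall z w, modulus z <= r0 -> modulus w <= r0 ->
     modulus (G0 z - G0 w) <= K * modulus (z - w)) ->
  (forall z w, modulus z <= r0 -> modulus w <= r0 ->
     modulus (G1 z - G1 w) <= K * modulus (z - w)) ->
  1 < modulus (G0 0) -> 0 < modulus (G1 0) < 1 ->
  exists r s : R, [/\ 0 < r <= r0, 0 < s < 1, 4 * K * r <= 1 - s,
    forall z, modulus z <= r -> s^-1 <= modulus (G0 z) &
    forall z, modulus z <= r -> G1 z != 0 /\ modulus (G1 z) <= s].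
Proof.
move=> r00 K0 GK0 GK1; set a := modulus (G0 0); set b := modulus (G1 0).
move=> a1 /andP[b0 b1].
(* The two entries are the inverse of the midpoint of 1 and a, and the midpoint of b and 1. *)
pose s := Num.max (2 / (1 + a)) ((1 + b) / 2).
have sa : 2 / (1 + a) <= s by rewrite le_max lexx.
have sb : (1 + b) / 2 <= s by rewrite le_max lexx orbT.
have s0 : 0 < s by apply: lt_le_trans sb; lra.
have s1 : s < 1.
  by rewrite gt_max; apply/andP; split; [rewrite ltr_pdivrMr; lra|lra].
have sV : s^-1 <= (1 + a) / 2.
  by rewrite -[leRHS]invrK lef_pV2 ?posrE ?invr_gt0// ?invf_div//; lra.
(* Allowed variation of the germs: the gaps from a and b to those midpoints, b / 2 to keep [G1]
   nonzero, and 1 - s for the stability condition. *)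
pose c := Num.min (Num.min ((a - 1) / 2) ((1 - b) / 2)) (Num.min (b / 2) (1 - s)).
have [ca cb cb2 cs] : [/\ c <= (a - 1) / 2, c <= (1 - b) / 2, c <= b / 2 & c <= 1 - s].
  by rewrite /c !ge_min !lexx !orbT.
have c0 : 0 < c by rewrite /c !lt_min; lra.
pose r := Num.min r0 (c / (4 * (K + 1))).
have K1 : 0 < 4 * (K + 1) by lra.
have rr0 : r <= r0 by rewrite ge_min lexx.
have r_gt0 : 0 < r by rewrite lt_min r00 divr_gt0.
have rc : r * (4 * (K + 1)) <= c by rewrite -ler_pdivlMr// ge_min lexx orbT.
have Kr0 : 0 <= K * r by rewrite mulr_ge0// ltW.
have m0 : modulus (0 : C) <= r0 by rewrite modulus0 ltW.
have Kz z : modulus z <= r -> K * modulus z <= K * r by exact: ler_wpM2l.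
exists r, s; rewrite r_gt0 rr0 s0 s1; split => // [|z zr|z zr]; first lra.
  have := GK0 0 z m0 (le_trans zr rr0); rewrite sub0r modulusN -/a.
  have := modulusD (G0 0 - G0 z) (G0 z); rewrite subrK -/a.
  by have := Kz z zr; lra.
have := GK1 0 z m0 (le_trans zr rr0); rewrite sub0r modulusN => h1.
have := modulusD (G1 0 - G1 z) (G1 z); rewrite subrK -/b => h2.
have := modulusD (G1 z - G1 0) (G1 0); rewrite subrK -/b modulus_distC => h3.
have h4 := Kz z zr; split; last lra.
by rewrite -modulus_gt0; lra.
Qed.

Lemma orbit_dense p q (f1 : S -> S) p' q' (f0 := ratmap p q) :
  q != 0 -> coprimep p q -> continuous f0 -> f1 = ratmap p' q' ->
  f0 (fin 0) = fin 0 -> f1 (fin 0) = fin 0 ->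
  1 < modulus (deriv_at f0 (fin 0)) -> 0 < modulus (deriv_at f1 (fin 0)) < 1 ->
  closure [set x : C | exists n m : nat,
    x = deriv_at f0 (fin 0) ^+ n * deriv_at f1 (fin 0) ^+ m] = [set: C] ->
  exists2 r : R, 0 < r & forall z, modulus z < r -> z != 0 ->
    dense (semigroup_orbit f0 f1 (fin z)).
Proof.
move=> q0 pq f0C f1E f00 f10.
have [G0 [r0 [K0 [[r00 K00 -> f0G GK0] back]]]] := ratmap_germ p q f00.
rewrite f1E in f10 *.
have [G1 [r1 [K1 [[r10 K10 -> f1G GK1] _]]]] := ratmap_germ p' q' f10.
move=> mu1 nu01 dns.
pose rm := Num.min r0 r1; pose K := Num.max K0 K1.
have [rm0 rm1] : rm <= r0 /\ rm <= r1 by rewrite !ge_min !lexx orbT.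
have [KK0 KK1] : K0 <= K /\ K1 <= K by rewrite !le_max !lexx orbT.
have rm_gt0 : 0 < rm by rewrite lt_min r00.
have K_ge0 : 0 <= K by exact: le_trans KK0.
have GK0m z w : modulus z <= rm -> modulus w <= rm ->
    modulus (G0 z - G0 w) <= K * modulus (z - w).
  move=> zr wr; apply: le_trans (GK0 _ _ (le_trans zr rm0) (le_trans wr rm0)) _.
  by rewrite ler_wpM2r ?modulus_ge0.
have GK1m z w : modulus z <= rm -> modulus w <= rm ->
    modulus (G1 z - G1 w) <= K * modulus (z - w).
  move=> zr wr; apply: le_trans (GK1 _ _ (le_trans zr rm1) (le_trans wr rm1)) _.
  by rewrite ler_wpM2r ?modulus_ge0.
have [r [s [/andP[r_gt0 rrm] s01 Kr Gs0 Gs1]]] :=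
  exists_germ_radius _ _ _ _ rm_gt0 K_ge0 GK0m GK1m mu1 nu01.
have {}GK0 z w : modulus z <= r -> modulus w <= r ->
    modulus (G0 z - G0 w) <= K * modulus (z - w).
  by move=> zr wr; apply: GK0m; [exact: le_trans zr rrm|exact: le_trans wr rrm].
have {}GK1 z w : modulus z <= r -> modulus w <= r ->
    modulus (G1 z - G1 w) <= K * modulus (z - w).
  by move=> zr wr; apply: GK1m; [exact: le_trans zr rrm|exact: le_trans wr rrm].
have {}f0G z : modulus z <= r -> f0 (fin z) = fin (z * G0 z).
  by move=> zr; apply: f0G; exact: le_trans (le_trans zr rrm) rm0.
have {}f1G z : modulus z <= r -> ratmap p' q' (fin z) = fin (z * G1 z).
  by move=> zr; apply: f1G; exact: le_trans (le_trans zr rrm) rm1.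
have rr0 := le_trans rrm rm0.
have s0 : 0 < s by case/andP: s01.
have s1 : s < 1 by case/andP: s01.
have [||d d0 dP] := back _ (r / 2).
- by rewrite -modulus_gt0; apply: lt_trans mu1.
- by rewrite divr_gt0//=; apply: le_trans rr0; lra.
(* As |G0| >= 1 here, preimages do not leave the disc of radius rho, so the local inverse can be
   iterated; r / 2 meets the requirement 2 |u n| <= r. *)
pose rho := Num.min d (r / 2).
have rho0 : 0 < rho by rewrite lt_min d0 divr_gt0.
have rhod : rho <= d by rewrite ge_min lexx.
have rhor : 2 * rho <= r by rewrite -ler_pdivlMl// mulrC ge_min lexx orbT.
have [bk bkP] : {bk : C -> C & forall y, modulus y <= rho ->
    modulus (bk y) <= rho /\ y = bk y * G0 (bk y)}.
  apply: (@choice _ _ (fun y u => modulus y <= rho ->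
    modulus u <= rho /\ y = u * G0 u)) => y.
  have [yr|yr] := boolP (modulus y <= rho); last by exists 0.
  have [u ur uy] := dP _ (le_trans yr rhod); exists u => _; split => //.
  apply: le_trans yr; rewrite -uy modulusM ler_peMr ?modulus_ge0//.
  apply: le_trans (Gs0 u _); first by rewrite invf_ge1// ltW.
  by apply: le_trans ur _; lra.
pose u y n := iter n bk y.
have ur y n : modulus y <= rho -> modulus (u y n) <= rho.
  by move=> yr; elim: n => [//|n IHn]; rewrite /u iterS; exact: (bkP _ IHn).1.
have uS y n : modulus y <= rho -> u y n = u y n.+1 * G0 (u y n.+1).
  by move=> yr; rewrite /u iterS; exact: (bkP _ (ur y n yr)).2.
have rho_r x : modulus x <= rho -> modulus x <= r.
  by move=> xr; apply: le_trans xr _; lra.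
have uD y n : modulus y <= rho -> modulus (u y n) <= s ^+ n * modulus y.
  move=> yr; apply: (backward_orbit_decay G0 r s (u y) n s0 Gs0) => k.
  by split; [exact: rho_r (ur _ _ yr)|exact: uS].
have uy y n : modulus y <= rho -> iter n f0 (fin (u y n)) = fin y.
  move=> yr; elim: n => [//|n IHn].
  by rewrite iterSr f0G ?rho_r ?ur// -uS.
exists r => // z /ltW zr z0 O O0 oO.
have [v [e [v0 e0 vO]]] := open_sphere_fin O oO O0.
have my : modulus (rho%:C%C : C) = rho by rewrite modulus_real ger0_norm// ltW.
have [n [x [b [xr xb bv]]]] : exists n x b,
    [/\ modulus x <= rho, iter n f0 (fin x) = fin b & modulus (b - v) < e].
  apply: (iterates_hit_ball p q rho s e (u rho%:C%C) rho%:C%C v) => //.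
  - by rewrite (ltW s0).
  - by move=> n; rewrite -{2}my uD// my.
  - by move=> n; rewrite uy// my.
  - by rewrite -modulus_gt0 my.
have fnC : {for fin x, continuous (iter n f0)}.
  elim: (n) => [|k IHk]; first exact: cvg_id.
  exact: (@continuous_comp _ _ _ (iter k f0) f0 _ IHk (f0C _)).
have Ofx : nbhs (iter n f0 (fin x)) O.
  by rewrite xb; apply: open_nbhs_nbhs; split => //; exact: vO.
have [t t0 tO] := nbhs_fin _ _ (fnC _ Ofx).
(* The target must be nonzero, since relative closeness to the backward orbit of 0 is void. The
   errors t / 4 from [x] to [y] and from [y] to the orbit stay below t. *)
have [y [y0 yr yx]] : exists y, [/\ y != 0, modulus y <= rho &
    modulus (y - x) <= t / 4].
  have [x0|x0] := eqVneq x 0; last first.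
    by exists x; rewrite subrr modulus0 divr_ge0// ltW.
  pose a := Num.min (t / 4) rho.
  have a0 : 0 < a by rewrite lt_min divr_gt0.
  have ma : modulus (a%:C%C : C) = a by rewrite modulus_real ger0_norm// ltW.
  exists a%:C%C; rewrite -modulus_gt0 x0 subr0 ma.
  by split; rewrite // ge_min lexx ?orbT.
have t40 : 0 < t / 4 by rewrite divr_gt0.
have uP k : 2 * modulus (u y k) <= r /\ u y k = u y k.+1 * G0 (u y k.+1).
  by split; [have := ur y k yr; lra|exact: uS].
have [n' [m [n'0 xr1 xr0 close]]] := two_germs_orbit_near G0 G1 r K s (u y) z _
  s01 K_ge0 Kr GK0 GK1 Gs0 Gs1 dns uP y0 z0 zr t40.
set xm := iter m (fun w => w * G1 w) z in xr0 close.
set xn := iter n' (fun w => w * G0 w) xm in close.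
have xmE : iter m (ratmap p' q') (fin z) = fin xm.
  by apply: (iter_fin _ _ r) => // k /ltnW; exact: xr1.
have xnE : iter n' f0 (fin xm) = fin xn.
  by apply: (iter_fin _ _ r) => // k /ltnW; exact: xr0.
exists (iter n f0 (fin xn)); split.
  apply: tO; have := modulus_triangle y xn x; rewrite [u y 0%N]/= in close.
  lra.
exists (iter (n + n') f0 \o iter m (ratmap p' q')).
  by apply: semigroup_iter; rewrite addn_gt0 n'0 orbT.
by rewrite /= xmE iterD xnE.
Qed.

End DenseOrbits.

Theorem theorem2p3 (R : realType)
  (f0 f1 : Cplx R -> sphere R -> sphere R) (p0 p1 : R) (mu nu : Cplx R -> Cplx R)
  (hf0 : analytic_family f0) (hf1 : analytic_family f1)
  (hp0 : 0 < p0 < 1) (hp1 : 0 < p1 < 1) (hp : p0 + p1 = 1)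
  (hmu : forall l, modulus l < 1 -> mu l = deriv_at (f0 l) (fin 0))
  (hnu : forall l, modulus l < 1 -> nu l = deriv_at (f1 l) (fin 0))
  (ha : forall l, modulus l < 1 ->
     [/\ f0 l (fin 0) = fin 0, f1 l (fin 0) = fin 0,
         1 < modulus (mu l) & modulus (nu l) < 1])
  (hb : forall l, modulus l < 1 ->
     [/\ superattracting_fixed (f0 l) (infty R),
         exists2 d : nat, (2 <= d)%N & local_degree (f0 l) (infty R) d
       & f1 l (infty R) = fin 0])
  (hc : forall l, modulus l < 1 ->
     hyperbolic (f0 l) /\
     forall (n : nat) (a : sphere R),
       attracting_periodic (f0 l) n a -> a <> infty R ->
       exists k : nat, immediate_basin (f0 l) (infty R) (iter k (f1 l) a))
  (hd : forall l, modulus l < 1 ->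
     (0 < p0%:E * lne (modulus (mu l))%:E + p1%:E * lne (modulus (nu l))%:E)%E)
  (l : Cplx R) (hl : modulus l < 1)
  (hS : closure [set x : Cplx R | exists n m : nat, x = mu l ^+ n * nu l ^+ m]
        = [set: Cplx R]) :
  exists2 r : R, 0 < r &
    forall z : Cplx R, modulus z < r -> z != 0 ->
      dense (semigroup_orbit (f0 l) (f1 l) (fin z)).
Proof.
have [f00 f10 mu1 nu1] := ha l hl.
have [[_ [p [q [q0 pq f0E _]]]] f0C] := hf0 l hl.
have [[_ [p' [q' [_ _ f1E _]]]] _] := hf1 l hl.
(* If nu were 0, its logarithm would be -oo and, p1 being positive and ln |mu| finite, the sum in
   (d) would be -oo. *)
have nu0 : 0 < modulus (nu l).
  rewrite lt0r modulus_ge0 andbT; apply/negP => /eqP nu0.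
  have /andP[p1_gt0 _] := hp1.
  have := hd l hl; rewrite nu0 (@le0_lneNy _ 0%:E)// gt0_muleNy ?lte_fin//.
  by rewrite lne_EFin// (lt_trans ltr01).
(* Joint continuity of the family, restricted to the slice of the fixed parameter. *)
have cf0 : continuous (f0 l).
  move=> z; have lz : (l, x) @[x --> z] --> (l, z).
    exact: (@cvg_pair _ _ _ (nbhs z) (nbhs l) (nbhs z) _ _ _ (fun=> l) id (cvg_cst l) cvg_id).
  exact: cvg_comp lz (f0C z).1.
rewrite hmu// in mu1 hS; rewrite hnu// in nu0 hS.
have nu01 : 0 < modulus (deriv_at (f1 l) (fin 0)) < 1.
  by rewrite nu0 -hnu//; have [] := ha l hl.
rewrite f0E in f00 mu1 hS cf0 *.
exact: orbit_dense q0 pq cf0 f1E f00 f10 mu1 nu01 hS.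
Qed.
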